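(* Let $Z$ be a random variable on a probability space $(\Omega,\mathcal{F},\mathbf{P})$ taking values in the positive integers $\{1,2,3,\ldots\}$, and let $\{\mathcal{F}_n\}_{n\ge 0}$ be an increasing sequence of sub-$\sigma$-fields of $\mathcal{F}$. Let $$Y=\sum_{n=0}^\infty \mathbf{P}(Z=n+1\mid \mathcal{F}_n).$$ Then $Y\preceq \mathcal{E}$, where $\mathcal{E}$ denotes an exponential random variable of mean one.
   Context: For real random variables $X,Y$, one writes $Y\preceq X$ if and only if $\mathbf{E}\,\phi(Y)\le \mathbf{E}\,\phi(X)$ for every convex function $\phi:\mathbb{R}\to\mathbb{R}$, where both expectations are allowed to be infinite. $Z$ is not assumed to be a stopping time of, or measurable with respect to, the filtration $\{\mathcal{F}_n\}$. *)

(* Defs.v *)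
From HB Require Import structures.
From mathcomp Require Import all_boot all_order all_algebra.
From mathcomp Require Import all_classical all_reals all_analysis.

Set Implicit Arguments.
Unset Strict Implicit.
Unset Printing Implicit Defensive.

Import Order.TTheory GRing.Theory Num.Theory.
Import numFieldNormedType.Exports.

Local Open Scope classical_set_scope.
Local Open Scope ring_scope.

Definition filtration (d : measure_display) (T : measurableType d)
    (F : nat -> set_system T) :=
  [/\ forall n, sigma_algebra [set: T] (F n),
      forall n, F n `<=` @measurable d T &
      {homo F : m n / (m <= n)%N >-> m `<=` n}].

Section conditional.
Context (d : measure_display) (T : measurableType d) (R : realType).
Variables (P : probability T R) (G : set_system T).

(* [f] is a version of E[X | G]; measurability of [f] with respect to G is
   spelled out on preimages, and integrability is with respect to [P]. *)
Definition is_cond_expectation (X f : T -> R) :=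
  [/\ forall B : set R, measurable B -> G (f @^-1` B),
      P.-integrable [set: T] (EFin \o f) &
      forall A, G A -> (\int[P]_(w in A) (f w)%:E = \int[P]_(w in A) (X w)%:E)%E].

Definition is_cond_probability (A : set T) (f : T -> R) :=
  is_cond_expectation (\1_A) f.

End conditional.

(* Only the laws matter, so the two variables may live on different probability
   spaces.  Expectations are extended-real.  The library reads +oo - oo as -oo,
   but this does not arise for integrable variables: a convex function is bounded
   below by an affine one, so the negative part of [phi \o X] is integrable. *)
Definition convex_le (R : realType)
    (d1 : measure_display) (T1 : measurableType d1) (P1 : probability T1 R)
    (d2 : measure_display) (T2 : measurableType d2) (P2 : probability T2 R)
    (Y : T1 -> R) (X : T2 -> R) :=
  forall phi : R -> R, convex_function [set: R^o] phi ->
    ('E_P1[phi \o Y] <= 'E_P2[phi \o X])%E.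

Definition exponential_law (R : realType) (d : measure_display)
    (T : measurableType d) (P : probability T R) (rate : R) (X : {RV P >-> R}) :=
  forall A : set R, measurable A -> distribution P X A = exponential_prob rate A.

(* Main.v *)
(* Put S_N = sum_(k < N) p_k, and let psi(x) = E (x + X - c)^+ be the potential
   of the hinge (x - c)^+ for the exponential law; explicitly psi = hinge + g
   with g(x) = exp(min(x - c, 0)) = psi'(x).  As psi is convex,
   psi(S_(n+1)) - psi(S_n) <= p_n g(S_(n+1)), and since S_(n+1) is F_n-measurable
   the expectation of the right-hand side is E (1_(Z = n+1) g(S_(n+1))), which is
   at most E (1_(Z = n+1) g(S_N)) for n < N.  Summing over n,
   E psi(S_N) - psi(0) <= E g(S_N), that is, E (S_N - c)^+ <= psi(0)
   = E (X - c)^+.  Together with E Y = sum_n P(Z = n+1) = 1 = E X, this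
   domination of hinges extends to all convex functions, which on the positive
   half-line are, up to an affine term, limits from below of nonnegative
   combinations of hinges. *)
Require Import Defs.
From HB Require Import structures.
From mathcomp Require Import all_boot all_order all_algebra.
From mathcomp Require Import all_classical all_reals all_analysis.
From mathcomp Require Import measurable_realfun.
From mathcomp Require Import ring lra zify.

Set Implicit Arguments.
Unset Strict Implicit.
Unset Printing Implicit Defensive.

Import Order.TTheory GRing.Theory Num.Theory.
Import numFieldNormedType.Exports.

Local Open Scope classical_set_scope.
Local Open Scope ring_scope.

(** * Convex functions on the line and hinges *)

Section real_convexity.
Variables (R : realType) (phi : R -> R).

(** Convexity with denominators cleared: degenerate triples are allowed, and instances can be passed
    directly to arithmetic tactics. *)
Definition three_chord := forall a b c : R, a <= b -> b <= c ->
  (c - a) * phi b <= (c - b) * phi a + (b - a) * phi c.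

Lemma convex_three_chord :
  convex_function [set: R^o] phi -> three_chord.
Proof.
move=> cphi a b c ab bc.
have [ac|ac] := eqVneq a c.
  have -> : b = a by apply/eqP; rewrite eq_le ab andbT ac.
  by rewrite -ac !subrr !mul0r addr0.
have ac0 : 0 < c - a by rewrite subr_gt0 lt_neqAle ac (le_trans ab).
have t0 : 0 <= (c - b) / (c - a) by apply: divr_ge0; [rewrite subr_ge0|exact: ltW].
have t1 : (c - b) / (c - a) <= 1 by rewrite ler_pdivrMr// mul1r lerD2l lerN2.
have /(_ a c) := cphi (Itv01 t0 t1).
rewrite !inE => /(_ I I).
rewrite convRE [X in phi X](_ : _ = b); last first.
  by rewrite [LHS]convRE /= /unstable.onem; field; rewrite gt_eqF.
rewrite /= /unstable.onem.
rewrite -(ler_pM2l ac0) => /le_trans; apply.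
by rewrite le_eqVlt; apply/orP; left; apply/eqP; field; rewrite gt_eqF.
Qed.

Hypothesis cphi : three_chord.

(** Both [a + h] and [b] lie in [[a, b + h]], with complementary barycentric weights, so the two
    chord inequalities over that interval add up to the claim. *)
Lemma three_chord_increment a b h : 0 <= h -> a <= b ->
  phi (a + h) - phi a <= phi (b + h) - phi b.
Proof.
move=> h0 ab.
have [<-//|neqab] := eqVneq a b.
have ltab : a < b by rewrite lt_neqAle neqab.
have H1 := @cphi a (a + h) (b + h) ltac:(lra) ltac:(lra).
have H2 := @cphi a b (b + h) ltac:(lra) ltac:(lra).
have d0 : 0 < b + h - a by lra.
rewrite -(ler_pM2l d0); nra.
Qed.

(** The slope between [x] and [x + h] lies between the slopes of the chords over [[x - 1, x]] and
    [[x, x + 1]]. The resulting continuity is what makes [phi] measurable. *)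
Lemma three_chord_lipschitz x h : `|h| <= 1 ->
  `|phi (x + h) - phi x| <=
  `|h| * (`|phi (x + 1) - phi x| + `|phi x - phi (x - 1)|).
Proof.
move=> h1.
set u := phi (x + 1) - phi x; set v := phi x - phi (x - 1).
have nu := ler_norm u; have nv := ler_norm v.
have nu' := ler_norm (- u); have nv' := ler_norm (- v).
rewrite !normrN in nu' nv'.
move: h1; have [h0|/ltW h0] := leP 0 h.
- rewrite (ger0_norm h0) => h1.
  have H1 := @cphi x (x + h) (x + 1) ltac:(lra) ltac:(lra).
  have H2 := @cphi (x - 1) x (x + h) ltac:(lra) ltac:(lra).
  by rewrite ler_norml; apply/andP; split; rewrite /u /v in nu nv nu' nv' *; nra.
- rewrite (ler0_norm h0) => h1.
  have H1 := @cphi (x - 1) (x + h) x ltac:(lra) ltac:(lra).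
  have H2 := @cphi (x + h) x (x + 1) ltac:(lra) ltac:(lra).
  by rewrite ler_norml; apply/andP; split; rewrite /u /v in nu nv nu' nv' *; nra.
Qed.

Lemma three_chord_continuous : continuous phi.
Proof.
move=> x; apply/cvgrPdist_le => e e0.
set M := `|phi (x + 1) - phi x| + `|phi x - phi (x - 1)|.
have M0 : 0 <= M by rewrite addr_ge0.
(* The bound 1 keeps [y] in the range of the Lipschitz estimate; [M + 1] avoids a division by zero
   when [M = 0]. *)
have d0 : 0 < Num.min 1 (e / (M + 1)).
  by rewrite lt_min ltr01 divr_gt0// ltr_wpDl.
near=> y.
have : `|x - y| <= Num.min 1 (e / (M + 1)).
  by near: y; exact: (@cvgr_dist_le _ _ _ _ _ id x cvg_id).
rewrite le_min => /andP[yx1 yx2].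
have := @three_chord_lipschitz x (y - x); rewrite -/M subrKC (distrC y) (distrC (phi y)).
move=> /(_ yx1) /le_trans; apply.
rewrite ler_pdivlMr in yx2; last by rewrite ltr_wpDl.
by have := normr_ge0 (x - y); nra.
Unshelve. all: by end_near. Qed.

End real_convexity.

Definition hinge (R : realType) (c x : R) : R := Num.max (x - c) 0.

Section hinge.
Variable R : realType.
Implicit Types c x : R.

Lemma hinge_ge0 c x : 0 <= hinge c x.
Proof. by rewrite le_max lexx orbT. Qed.

Lemma hinge_ge c x : c <= x -> hinge c x = x - c.
Proof. by move=> cx; rewrite /hinge max_l// subr_ge0. Qed.

Lemma hinge_le c x : x <= c -> hinge c x = 0.
Proof. by move=> xc; rewrite /hinge max_r// subr_le0. Qed.

Lemma continuous_hinge c : continuous (hinge c).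
Proof.
move=> x; apply: (@continuous_max _ R (fun y => y - c) (fun=> 0)).
  exact: (cvgB cvg_id (cvg_cst c)).
exact: cvg_cst.
Qed.

Lemma measurable_hinge c : measurable_fun [set: R] (hinge c).
Proof. by apply: continuous_measurable_fun; exact: continuous_hinge. Qed.

End hinge.

(** * Approximation of a convex function from below by hinges on a mesh *)

Section hinge_approximation.
Variables (R : realType) (phi : R -> R) (h : R).

Definition mesh_slope (k : nat) := (phi (k%:R * h) - phi (k%:R * h - h)) / h.

(** The jump of slope at the mesh point [k%:R * h], a second difference of [phi]. At 0 it is the
    whole slope, since all hinges vanish to the left. *)
Definition mesh_weight (k : nat) :=
  if k is j.+1 then mesh_slope k - mesh_slope j else mesh_slope 0.

(* Left of every mesh point this has the slope of the preceding chord of [phi],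
   so that it stays below [phi - phi 0] on the positive half-line. *)
Definition mesh_approx (N : nat) (x : R) :=
  \sum_(k < N.+1) mesh_weight k * hinge (k%:R * h) x.

Hypotheses (cphi : three_chord phi) (h0 : 0 < h).

(** Right of the last mesh point all hinges are active: the weights telescope to [mesh_slope N], and
    the constant collects the increments of the earlier chords. *)
Lemma mesh_approx_last N x : N%:R * h <= x ->
  mesh_approx N x =
  phi (N%:R * h - h) - phi (- h) + mesh_slope N * (x - N%:R * h).
Proof.
elim: N => [|N IH] Nx.
  rewrite /mesh_approx big_ord1 /= mul0r hinge_ge; last by rewrite mul0r in Nx.
  by rewrite sub0r subrr add0r.
have Nx' : N%:R * h <= x by apply: le_trans Nx; rewrite ler_pM2r// ler_nat.
rewrite /mesh_approx big_ord_recr /= -/(mesh_approx _ _) IH// hinge_ge//.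
rewrite /mesh_slope.
have -> : N.+1%:R * h - h = N%:R * h by rewrite mulrSr; ring.
by rewrite mulrSr; field; rewrite gt_eqF.
Qed.

Lemma chord_below (b x : R) : b <= x ->
  (phi b - phi (b - h)) / h * (x - b) <= phi x - phi b.
Proof.
have hpos := h0; move=> bx; have := @cphi (b - h) b x ltac:(lra) bx.
rewrite mulrAC ler_pdivrMr//; nra.
Qed.

(** On [[b - h, b]] a convex function lies below its chord; this is evaluated at [x - h]. *)
Lemma chord_above (b x : R) : b <= x -> x <= b + h ->
  phi (x - h) - phi (b - h) <= (phi b - phi (b - h)) / h * (x - b).
Proof.
have hpos := h0; move=> bx xb; have := @cphi (b - h) (x - h) b ltac:(lra) ltac:(lra).
rewrite mulrAC ler_pdivlMr//; nra.
Qed.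

(** The new hinge matters only beyond its mesh point. There the last chord, extended to the right,
    stays below [phi], and the constants compare because increments over length [h] grow from [- h]
    onwards. *)
Lemma mesh_approx_le N x : 0 <= x -> mesh_approx N x <= phi x - phi 0.
Proof.
move=> x0; elim: N => [|N IH].
  rewrite mesh_approx_last ?mul0r// sub0r subrr add0r subr0.
  have := chord_below x0; rewrite /mesh_slope !mul0r subr0; exact.
have [xN|/ltW Nx] := leP x (N.+1%:R * h).
  by rewrite /mesh_approx big_ord_recr /= (hinge_le xN) mulr0 addr0.
rewrite mesh_approx_last//.
have := chord_below Nx.
have := @three_chord_increment _ _ cphi (- h) (N.+1%:R * h - h) h (ltW h0).
rewrite /mesh_slope addNr subrK => H1 H2.
have /H1 : - h <= N.+1%:R * h - h.
  by rewrite -[leLHS]add0r lerD2r mulr_ge0// ltW.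
lra.
Qed.

(** With the upper bound this traps the approximation between [phi] and its shift by [h]. Beyond the
    stated range the approximation stays affine and the bound may fail. *)
Lemma mesh_approx_ge N x : 0 <= x -> x <= N.+1%:R * h ->
  phi (x - h) - phi (- h) <= mesh_approx N x.
Proof.
move=> x0; elim: N => [|N IH] xN.
  rewrite mul1r in xN.
  rewrite mesh_approx_last ?mul0r// sub0r subrr add0r subr0.
  have := @chord_above 0 x x0.
  by rewrite /mesh_slope !mul0r add0r subr0 sub0r => /(_ xN).
have [xN'|/ltW Nx] := leP x (N.+1%:R * h).
  rewrite /mesh_approx big_ord_recr /= (hinge_le xN') mulr0 addr0.
  exact: IH.
rewrite mesh_approx_last//.
have := @chord_above _ x Nx.
rewrite /mesh_slope => H1.
have /H1 : x <= N.+1%:R * h + h by move: xN; rewrite mulrSr mulrDl mul1r.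
lra.
Qed.

(** By convexity [phi] is at most 0 on [[-1, 0]], which contains [- h], so the initial slope is
    nonnegative; the later weights are so because slopes increase. *)
Lemma mesh_weight_ge0 k : phi 0 = 0 -> phi (-1) = 0 -> h <= 1 ->
  0 <= mesh_weight k.
Proof.
have hpos := h0; move=> phi0 phi1 h1; case: k => [|k] /=.
  rewrite /mesh_slope mul0r sub0r phi0 divr_ge0 ?(ltW h0)// sub0r oppr_ge0.
  have := @cphi (-1) (- h) 0 ltac:(lra) ltac:(lra).
  by rewrite phi0 phi1; lra.
rewrite subr_ge0 ler_pM2r ?invr_gt0//.
have := @three_chord_increment _ _ cphi (k%:R * h - h) (k.+1%:R * h - h) h.
rewrite !subrK; apply; first exact: ltW.
by rewrite lerD2r ler_pM2r// ler_nat.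
Qed.

End hinge_approximation.

(** A mesh of width [1 / (m + 1)] with [(m + 1)^2] steps refines while reaching beyond [m + 1], so
    it eventually covers [x]; the shifted lower bound converges by continuity of [phi]. *)
Lemma mesh_approx_cvg (R : realType) (phi : R -> R) (x : R) :
  three_chord phi -> phi 0 = 0 -> 0 <= x ->
  (fun m => mesh_approx phi m.+1%:R^-1 (m.+1 * m.+1) x) @ \oo --> phi x.
Proof.
move=> cphi phi0 x0.
have ch : (fun m => m.+1%:R^-1 : R) @ \oo --> (0 : R) by exact: cvg_harmonic.
apply: (@squeeze_cvgr _ _ _ _
    (fun m => phi (x - m.+1%:R^-1) - phi (- m.+1%:R^-1)) (cst (phi x))).
- near=> m.
  have h0 : 0 < m.+1%:R^-1 :> R by rewrite invr_gt0.
  have := mesh_approx_le cphi h0 (m.+1 * m.+1) x0; rewrite phi0 subr0 => ->.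
  rewrite andbT; apply: mesh_approx_ge => //.
  rewrite -ler_pdivrMr// invrK.
  have : x <= m%:R by near: m; exact: nbhs_infty_ger.
  move=> /(ler_wpM2r (ler0n R m.+1)) /le_trans; apply.
  rewrite -natrM ler_nat; lia.
- have c1 : phi (x - m.+1%:R^-1) @[m --> \oo] --> phi (x - 0).
    apply: (@continuous_cvg _ _ _ _ _ (fun m => x - m.+1%:R^-1) phi).
      exact: three_chord_continuous.
    exact: (cvgB (cvg_cst x) ch).
  have c2 : phi (- m.+1%:R^-1) @[m --> \oo] --> phi (- 0).
    apply: (@continuous_cvg _ _ _ _ _ (fun m : nat => - m.+1%:R^-1 : R) phi).
      exact: three_chord_continuous.
    exact: (cvgN ch).
  have := cvgB c1 c2; rewrite subr0 oppr0 phi0 subr0; exact.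
- exact: cvg_cst.
Unshelve. all: by end_near. Qed.

(** * From hinges to convex functions *)

Section stop_loss_order.
Local Open Scope ereal_scope.
Context (R : realType).

Lemma integral_mesh_approx (d : measure_display) (T : measurableType d)
    (P : {measure set T -> \bar R}) (W : T -> R) (phi : R -> R) (h : R) N :
  measurable_fun [set: T] W -> (forall k, (0 <= mesh_weight phi h k)%R) ->
  \int[P]_w (mesh_approx phi h N (W w))%:E =
  \sum_(k < N.+1) (mesh_weight phi h k)%:E *
     \int[P]_w (hinge (k%:R * h) (W w))%:E.
Proof.
move=> mW w0.
have mh c : measurable_fun [set: T] (fun w => (hinge c (W w))%:E).
  by apply/measurable_EFinP; apply: measurableT_comp => //; exact: measurable_hinge.
under eq_integral => w _ do rewrite /mesh_approx -sumEFin.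
rewrite ge0_integral_sum//.
- apply: eq_bigr => k _; under eq_integral do rewrite EFinM.
  rewrite ge0_integralZl//= ?lee_fin ?w0// => w _.
  by rewrite lee_fin hinge_ge0.
- move=> k; under eq_fun do rewrite EFinM.
  exact: measurable_funeM.
- by move=> k w _; rewrite lee_fin mulr_ge0// hinge_ge0.
Qed.

Context (d1 : measure_display) (T1 : measurableType d1)
        (P1 : probability T1 R)
        (d2 : measure_display) (T2 : measurableType d2)
        (P2 : probability T2 R)
        (Y : T1 -> R) (X : T2 -> R).
Hypotheses (mY : measurable_fun [set: T1] Y) (mX : measurable_fun [set: T2] X).
Hypotheses (Y0 : forall w, (0 <= Y w)%R) (X0 : forall w, (0 <= X w)%R).
Hypothesis hYX : forall c, (0 <= c)%R ->
  \int[P1]_w (hinge c (Y w))%:E <= \int[P2]_w (hinge c (X w))%:E.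

(** The normalisation makes the mesh weights nonnegative, so the hypothesis on hinges passes to each
    approximation. The limit uses Fatou's lemma on the [Y] side and [f m <= phi] on the [X] side. *)
Let convex_le_normalized (phi : R -> R) :
  three_chord phi -> phi 0%R = 0%R -> phi (-1)%R = 0%R ->
  \int[P1]_w (phi (Y w))%:E <= \int[P2]_w (phi (X w))%:E.
Proof.
move=> cphi phi0 phi1.
pose f m x := mesh_approx phi m.+1%:R^-1 (m.+1 * m.+1) x.
have h0 m : (0 < m.+1%:R^-1 :> R)%R by rewrite invr_gt0.
have h1 m : (m.+1%:R^-1 <= 1 :> R)%R by rewrite invf_le1// ler1n.
have w0 m k : (0 <= mesh_weight phi m.+1%:R^-1 k)%R by exact: mesh_weight_ge0.
have f0 m x : (0 <= f m x)%R.
  by apply: sumr_ge0 => k _; rewrite mulr_ge0// hinge_ge0.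
have fphi m x : (0 <= x -> f m x <= phi x)%R.
  by move=> x0; rewrite (le_trans (mesh_approx_le _ _ _ x0))// phi0 subr0.
have mf m : measurable_fun [set: R] (f m).
  rewrite /f /mesh_approx; apply: measurable_sum => k.
  by apply: measurable_funM => //; exact: measurable_hinge.
have mphi : measurable_fun [set: R] phi.
  by apply: continuous_measurable_fun; exact: three_chord_continuous.
have -> : \int[P1]_w (phi (Y w))%:E =
          \int[P1]_w limn_einf (fun m => (f m (Y w))%:E).
  apply: eq_integral => w _; rewrite is_cvg_limn_einfE.
    apply/esym/cvg_lim => //; apply: cvg_EFin; first exact: nearW.
    exact: mesh_approx_cvg.
  apply/cvg_ex; exists (phi (Y w))%:E; apply: cvg_EFin; first exact: nearW.
  exact: mesh_approx_cvg.
apply: le_trans (fatou _ _ _ _) _ => //.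
- by move=> m; apply/measurable_EFinP; exact: measurableT_comp.
- by move=> m w _; rewrite lee_fin.
rewrite limn_einf_lim; apply: lime_le; first exact: is_cvg_einfs.
apply: nearW => m; apply: le_trans (ereal_inf_lbound _) _.
  by exists m => /=.
rewrite integral_mesh_approx//.
apply: (@le_trans _ _ (\int[P2]_w (f m (X w))%:E)).
  rewrite integral_mesh_approx//; apply: lee_sum => k _.
  by rewrite lee_wpmul2l ?lee_fin// hYX// mulr_ge0// invr_ge0.
apply: ge0_le_integral => //.
- by move=> w _; rewrite lee_fin.
- by apply/measurable_EFinP; exact: measurableT_comp.
- by apply/measurable_EFinP; exact: measurableT_comp.
- by move=> w _; rewrite lee_fin fphi.
Qed.

Hypotheses (iY : P1.-integrable [set: T1] (EFin \o Y))
           (iX : P2.-integrable [set: T2] (EFin \o X)).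
Hypothesis eqYX : \int[P1]_w (Y w)%:E = \int[P2]_w (X w)%:E.

Lemma stop_loss_convex_le (phi : R -> R) : three_chord phi ->
  \int[P1]_w (phi (Y w))%:E <= \int[P2]_w (phi (X w))%:E.
Proof.
move=> cphi.
(* [aff] is the line through the graph of [phi] at -1 and 0. Thus [rho] is normalised and
   nonnegative on the positive half-line, while equality of means makes the integrals of [aff]
   agree. *)
pose c := (phi 0 - phi (-1))%R.
pose aff x := (phi 0 + c * x)%R.
pose rho x := (phi x - aff x)%R.
have crho : three_chord rho.
  by move=> x y z xy yz; have := cphi _ _ _ xy yz; rewrite /rho /aff; nra.
have rho0 : rho 0%R = 0%R by rewrite /rho /aff; ring.
have rho1 : rho (-1)%R = 0%R by rewrite /rho /aff /c; ring.
have rho_ge0 x : (0 <= x -> 0 <= rho x)%R.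
  move=> x0; have := crho (-1)%R 0%R x ltac:(lra) x0.
  by rewrite rho0 rho1; nra.
have mrho : measurable_fun [set: R] rho.
  by apply: continuous_measurable_fun; exact: three_chord_continuous.
have mphi : measurable_fun [set: R] phi.
  by apply: continuous_measurable_fun; exact: three_chord_continuous.
have iaff d (T : measurableType d) (P : probability T R) (W : T -> R) :
    P.-integrable [set: T] (EFin \o W) ->
    P.-integrable [set: T] (EFin \o (aff \o W)) /\
    \int[P]_w (aff (W w))%:E = (phi 0%R)%:E + c%:E * \int[P]_w (W w)%:E.
  move=> iW.
  have icst : P.-integrable [set: T] (EFin \o cst (phi 0%R)).
    exact: finite_measure_integrable_cst.
  have icW : P.-integrable [set: T] (fun w => c%:E * (W w)%:E).
    exact: integrableZl.
  split.
    have -> : EFin \o (aff \o W) =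
              (EFin \o cst (phi 0%R)) \+ (fun w => c%:E * (W w)%:E).
      by apply/funext => w.
    exact: integrableD.
  under eq_integral => w _ do rewrite /aff EFinD EFinM.
  rewrite integralD// integralZl//; congr (_ + _).
  by rewrite integral_cst//= [P _]probability_setT mule1.
have [iaffY affY] := iaff _ _ _ _ iY.
have [iaffX affX] := iaff _ _ _ _ iX.
have [iphiX|niphiX] := pselect (P2.-integrable [set: T2] (EFin \o (phi \o X))).
  have irhoX : P2.-integrable [set: T2] (EFin \o (rho \o X)).
    rewrite (_ : _ \o _ = (EFin \o (phi \o X)) \- (EFin \o (aff \o X))).
      exact: integrableB.
    by apply/funext.
  have irhoY : P1.-integrable [set: T1] (EFin \o (rho \o Y)).
    apply/integrableP; split.
      by apply/measurable_EFinP; exact: measurableT_comp.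
    under eq_integral => w _ do rewrite gee0_abs ?lee_fin ?rho_ge0//.
    apply: le_lt_trans (convex_le_normalized crho rho0 rho1) _.
    exact: integrable_lty irhoX.
  have phiD d (T : measurableType d) (P : probability T R) (W : T -> R) :
      P.-integrable [set: T] (EFin \o (rho \o W)) ->
      P.-integrable [set: T] (EFin \o (aff \o W)) ->
      \int[P]_w (phi (W w))%:E =
      \int[P]_w (rho (W w))%:E + \int[P]_w (aff (W w))%:E.
    move=> irW iaW; rewrite -integralD//; apply: eq_integral => w _.
    by rewrite -EFinD /rho subrK.
  rewrite phiD// [leRHS]phiD// affY affX eqYX leeD2r//.
  exact: convex_le_normalized.
have mphiX : measurable_fun [set: T2] (EFin \o (phi \o X)).
  by apply/measurable_EFinP; exact: measurableT_comp.
(* As [phi \o X] dominates the integrable [aff \o X], only its positive part can fail to be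
   integrable. *)
suff -> : \int[P2]_w (phi (X w))%:E = +oo by rewrite leey.
have inegX : P2.-integrable [set: T2] (EFin \o (phi \o X))^\-.
  apply: le_integrable iaffX => //; first exact: measurable_funeneg.
  move=> w _; rewrite gee0_abs ?funeneg_ge0//= funenegE -EFinN -EFin_max lee_fin.
  rewrite ge_max normr_ge0 andbT -normrN (le_trans _ (ler_norm _))// lerN2.
  by rewrite -subr_ge0 rho_ge0.
rewrite integralE.
have -> : \int[P2]_w (EFin \o (phi \o X))^\+ w = +oo.
  apply/eqP; rewrite eq_le leey leNgt; apply/negP => posX; apply: niphiX.
  rewrite [X in _.-integrable _ X]funeposneg; apply: integrableB => //.
  apply/integrableP; split; first exact: measurable_funepos.
  by under eq_integral do rewrite gee0_abs ?funepos_ge0//.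
by rewrite addye// eqe_oppLR/= lt_eqF// integrable_lty.
Qed.

End stop_loss_order.

(** * The exponential law *)

Section exponential_hinge.
Local Open Scope ereal_scope.
Context (R : realType) (d : measure_display) (T : measurableType d)
  (Q : probability T R) (X : {RV Q >-> R}).
Hypothesis hX : exponential_law 1 X.

Let pdfE (x : R) : (0 <= x)%R -> exponential_pdf 1 x = expR (- x).
Proof. by move=> x0; rewrite exponential_pdfE//= mul1r mulN1r. Qed.

Lemma integral_expRN (a : R) :
  \int[lebesgue_measure]_(x in `[a, +oo[) (expR (- x))%:E = (expR (- a))%:E.
Proof.
have cN : continuous (fun x : R => expR (- x)).
  by move=> x; apply: continuous_comp; [exact: continuousN|exact: continuous_expR].
rewrite (@ge0_continuous_FTC2y _ _ (fun x => - expR (- x))%R _ 0%R)//.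
- by rewrite EFinN oppeK add0e.
- exact: continuous_subspaceT.
- by rewrite -oppr0; apply: cvgN; exact: cvgr_expR.
- by apply: cvgN; apply/cvg_at_right_filter; exact: cN.
- by move=> x _; rewrite derive1E derive_val /= mulrN1 opprK.
Qed.

Lemma exponential_tail (a : R) : (0 <= a)%R -> ccdf X a = (expR (- a))%:E.
Proof.
move=> a0; rewrite /ccdf hX// /exponential_prob.
rewrite integral_itv_obnd_cbnd; last first.
  apply/measurable_EFinP; apply: measurable_funTS.
  exact: measurable_exponential_pdf.
rewrite -integral_expRN; apply: eq_integral => x.
by rewrite inE/= in_itv/= andbT => ax; rewrite pdfE// (le_trans a0).
Qed.

Lemma exponential_ge0_ae : {ae Q, forall w, (0 <= X w)%R}.
Proof.
exists (X @^-1` `]-oo, 0%R[); split.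
- by rewrite -[_ @^-1` _]setTI; exact: measurable_funPT.
- have := hX (measurable_itv `]-oo, 0%R[).
  rewrite /distribution /pushforward => ->; rewrite /exponential_prob.
  apply: integral0_eq => x; rewrite /= in_itv/= => x0.
  by rewrite lt0_exponential_pdf.
- by move=> w /= /negP; rewrite -ltNge in_itv.
Qed.

(** Layer-cake formula and lack of memory: the hinge exceeds [r] exactly when [X] exceeds [c + r],
    and this tail factors as [expR (- c) * expR (- r)]. *)
Lemma exponential_hinge (c : R) : (0 <= c)%R ->
  \int[Q]_w (hinge c (X w))%:E = (expR (- c))%:E.
Proof.
move=> c0.
have mW : measurable_fun [set: T] (hinge c \o X).
  by apply: measurableT_comp => //; exact: measurable_hinge.
pose W : {RV Q >-> R} := mfun_Sub (mem_set mW).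
have := @ge0_expectation_ccdf _ _ _ Q W (fun w => hinge_ge0 c (X w)).
rewrite unlock /= => ->.
transitivity (\int[lebesgue_measure]_(r in `[0%R, +oo[)
    ((expR (- c))%:E * (expR (- r))%:E)).
  apply: eq_integral => r; rewrite inE/= in_itv/= andbT => r0.
  rewrite -EFinM -expRD -opprD -exponential_tail ?addr_ge0//.
  rewrite /ccdf /distribution /pushforward; congr (Q _).
  apply/seteqP; split => w /=; rewrite !in_itv/= !andbT /hinge.
    by rewrite lt_max (ltNge r 0%R) r0 orbF ltrBrDl.
  by move=> ?; rewrite lt_max ltrBrDl; apply/orP; left.
rewrite ge0_integralZl//=.
- by rewrite integral_expRN oppr0 expR0 mule1.
- apply/measurable_EFinP; apply: measurable_funTS.
  by apply: measurableT_comp => //; exact: measurable_expR.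
Qed.

End exponential_hinge.

(** * Conditional probabilities *)

Section staircase.
Variable R : realType.
Implicit Types (y : R) (m : nat).

(** For [y >= 0], the integer part of [y] capped at [m], written through level sets so that
    integrating against it means integrating over those sets. *)
Definition staircase m y : R := \sum_(j < m) (j.+1%:R <= y)%R%:R.

Lemma staircase_ge0 m y : 0 <= staircase m y.
Proof. by apply: sumr_ge0 => j _; rewrite ler0n. Qed.

Let ones m : \sum_(j < m) 1 = m%:R :> R.
Proof. by rewrite sumr_const card_ord. Qed.

Lemma staircase_le m y : 0 <= y -> staircase m y <= y.
Proof.
move=> y0; elim: m => [|m IH]; first by rewrite /staircase big_ord0.
have [my|ym] := leP m.+1%:R y.
  apply: le_trans my; rewrite -ones; apply: ler_sum => j _.
  by rewrite lern1 leq_b1.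
by rewrite /staircase big_ord_recr/= (leNgt m.+1%:R) ym addr0.
Qed.

Lemma staircase_ge m y : y <= m.+1%:R -> y <= staircase m y + 1.
Proof.
elim: m => [|m IH] ym; first by rewrite /staircase big_ord0 add0r.
have [my|/ltW my] := leP m.+1%:R y; last first.
  apply: le_trans (IH my) _.
  by rewrite lerD2r /staircase big_ord_recr/= lerDl ler0n.
apply: le_trans ym _; rewrite -natr1 lerD2r.
rewrite -ones; apply: ler_sum => j _.
by rewrite (le_trans _ my)// ler_nat; exact: ltn_ord.
Qed.

End staircase.

(** * Pulling a bounded factor out of a conditional expectation *)

Section pull_out.
Local Open Scope ereal_scope.
Context (R : realType) (d : measure_display) (T : measurableType d)
  (P : probability T R).

Let integral_staircase (u h : T -> R) m :
  measurable_fun [set: T] u -> measurable_fun [set: T] h ->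
  (forall w, (0 <= u w)%R) ->
  \int[P]_w (u w * staircase m (m%:R * h w))%:E =
  \sum_(j < m) \int[P]_(w in [set w | (j.+1%:R <= m%:R * h w)%R]) (u w)%:E.
Proof.
move=> mu mh u0.
have mj (j : nat) : measurable_fun [set: T] (fun w => (j.+1%:R <= m%:R * h w)%R).
  by apply: measurable_fun_ler => //; exact: measurable_funM.
under eq_integral => w _ do rewrite /staircase mulr_sumr -sumEFin.
rewrite ge0_integral_sum//.
- apply: eq_bigr => j _; rewrite [RHS]integral_mkcond; apply: eq_integral => w _.
  rewrite patchE; case: ifPn; rewrite ?inE ?notin_setE /=.
    by move=> ->; rewrite mulr1.
  by move=> /negP/negbTE ->; rewrite mulr0.
- move=> j; apply/measurable_EFinP; apply: measurable_funM => //.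
  rewrite (_ : (fun _ => _) = \1_[set w | (j.+1%:R <= m%:R * h w)%R]).
    apply: measurable_indic; rewrite -[X in measurable X]setTI.
    exact: (mj j measurableT [set true]).
  by apply/funext => w; rewrite indicE mem_setE.
- by move=> j w _; rewrite lee_fin mulr_ge0.
Qed.

(* Approximating [h] by staircases from below reduces this to the defining
   property of the conditional expectation [q] of [u]. *)
Lemma pull_out_le (G : set_system T) (u q h : T -> R) :
  G `<=` @measurable d T ->
  measurable_fun [set: T] u -> (forall w, (0 <= u w)%R) ->
  measurable_fun [set: T] q -> (forall w, (0 <= q w <= 1)%R) ->
  (forall B, G B -> \int[P]_(w in B) (q w)%:E = \int[P]_(w in B) (u w)%:E) ->
  measurable_fun [set: T] h -> (forall w, (0 <= h w <= 1)%R) ->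
  (forall a : R, G [set w | (a <= h w)%R]) ->
  \int[P]_w (q w * h w)%:E <= \int[P]_w (u w * h w)%:E.
Proof.
move=> sG mu u0 mq q01 hq mh h01 hG.
have q0 w : (0 <= q w)%R by case/andP: (q01 w).
have h0 w : (0 <= h w)%R by case/andP: (h01 w).
apply/lee_addgt0Pr => e e0.
(* This gives [1 / m <= e], so that [s / m] approximates [h] from below within [e]. *)
pose m := (Num.truncn e^-1).+1.
have m0 : (0 < m%:R :> R)%R by [].
have me : (m%:R^-1 <= e)%R.
  by rewrite invf_ple ?posrE//; apply/ltW/truncnS_gt.
pose s w := staircase m (m%:R * h w).
have s0 w : (0 <= s w)%R by exact: staircase_ge0.
have ms : measurable_fun [set: T] s.
  apply: measurable_sum => j.
  rewrite (_ : (fun _ => _) = \1_[set w | (j.+1%:R <= m%:R * h w)%R]).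
    apply: measurable_indic; rewrite -[X in measurable X]setTI.
    have : measurable_fun [set: T] (fun w => j.+1%:R <= m%:R * h w)%R.
      by apply: measurable_fun_ler => //; exact: measurable_funM.
    by move=> /(_ measurableT [set true]); exact.
  by apply/funext => w; rewrite indicE mem_setE.
have sle w : (m%:R^-1 * s w <= h w)%R.
  by rewrite ler_pdivrMl// staircase_le// mulr_ge0// ltW.
have sge w : (h w <= m%:R^-1 * s w + m%:R^-1)%R.
  rewrite -[X in (_ + X)%R]mulr1 -mulrDr ler_pdivlMl// staircase_ge//.
  rewrite (@le_trans _ _ m%:R)%R// ?ler_nat//.
  by rewrite ger_pMr//; case/andP: (h01 w).
have qs : \int[P]_w (q w * s w)%:E = \int[P]_w (u w * s w)%:E.
  rewrite !integral_staircase//; apply: eq_bigr => j _; apply: hq.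
  rewrite (_ : [set _ | _] = [set w | (m%:R^-1 * j.+1%:R <= h w)%R])//.
  by apply/seteqP; split => w /=; rewrite ler_pdivrMl.
have mEM (f g : T -> R) : measurable_fun [set: T] f ->
    measurable_fun [set: T] g -> measurable_fun [set: T] (fun w => (f w * g w)%:E).
  by move=> mf mg; apply/measurable_EFinP; exact: measurable_funM.
have iM (f : T -> R) : measurable_fun [set: T] f -> (forall w, (0 <= f w)%R) ->
    \int[P]_w (f w * (m%:R^-1 * s w))%:E =
    m%:R^-1%:E * \int[P]_w (f w * s w)%:E.
  move=> mf f0; rewrite -ge0_integralZl//.
  - by apply: eq_integral => w _; rewrite -EFinM mulrCA.
  - exact: mEM.
  - by move=> w _; rewrite lee_fin mulr_ge0.
have mms : measurable_fun [set: T] (fun w => m%:R^-1 * s w)%R.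
  exact: measurable_funM.
(* The error costs at most [e] in total, since [q <= 1] and [P] has mass one. *)
apply: (@le_trans _ _ (\int[P]_w ((q w * (m%:R^-1 * s w))%:E + e%:E))).
  apply: ge0_le_integral => //.
  - by move=> w _; rewrite lee_fin mulr_ge0.
  - exact: mEM.
  - by apply: emeasurable_funD => //; exact: mEM.
  - move=> w _; rewrite -EFinD lee_fin.
    have := sge w; have /andP[_ q1] := q01 w; have := q0 w; have := me.
    have : (0 <= m%:R^-1 :> R)%R by rewrite invr_ge0 ltW.
    nra.
rewrite ge0_integralD//; last 3 first.
- by move=> w _; rewrite lee_fin mulr_ge0// mulr_ge0// invr_ge0 ltW.
- exact: mEM.
- by move=> w _; rewrite lee_fin ltW.
rewrite integral_cst//= [P _]probability_setT mule1 leeD2r//.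
rewrite iM// qs -iM//; apply: ge0_le_integral => //.
- by move=> w _; rewrite lee_fin mulr_ge0// mulr_ge0// invr_ge0 ltW.
- exact: mEM.
- exact: mEM.
- by move=> w _; rewrite lee_fin ler_wpM2l.
Qed.

End pull_out.

(** * Versions of a conditional probability with values in the unit interval *)

Section conditional_probability.
Local Open Scope ereal_scope.
Context (R : realType) (d : measure_display) (T : measurableType d)
  (P : probability T R).

(** On the set where [u] is negative, the integral of its absolute value is minus the assumed
    nonnegative one, hence 0; so that set is null. *)
Lemma ge0_ae_of_integral (u : T -> R) :
  P.-integrable [set: T] (EFin \o u) ->
  0 <= \int[P]_(w in [set w | (u w < 0)%R]) (u w)%:E ->
  {ae P, forall w, (0 <= u w)%R}.
Proof.
set B := [set w | (u w < 0)%R] => iu B0.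
have mu : measurable_fun [set: T] u by move/measurable_int : iu => /measurable_EFinP.
have mB : measurable B.
  have : measurable_fun [set: T] (fun w => u w < 0)%R by exact: measurable_fun_ltr.
  by move=> /(_ measurableT [set true]); rewrite setTI; exact.
have iuB : P.-integrable B (EFin \o u) by exact: integrableS iu.
have abs0 : \int[P]_(w in B) `|(EFin \o u) w| = 0.
  apply/eqP; rewrite eq_le integral_ge0 ?andbT//.
  under eq_integral.
    move=> w; rewrite inE => Bw /=.
    rewrite ltr0_norm// EFinN.
    over.
  by rewrite integralN ?oppe_le0// integrable_add_def.
have /ae_eq_integral_abs := abs0.
move=> /(_ mB (measurable_int _ iuB)).
apply: filterS => w /= Bw; rewrite leNgt; apply/negP => uw.
by have [uw0] := Bw uw; move: uw; rewrite uw0 ltxx.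
Qed.

Variables (G : set_system T) (A : set T) (f : T -> R).
Hypotheses (sigmaG : sigma_algebra [set: T] G) (GT : G `<=` @measurable d T).
Hypotheses (mA : measurable A) (hf : is_cond_probability P G A f).

Lemma measurable_cond_probability : measurable_fun [set: T] f.
Proof. by move=> _ B mB; rewrite setTI; apply: GT; case: hf => + _ _; exact. Qed.

(** The sets where [f < 0] and where [f > 1] belong to [G], so on them [f] may be replaced by the
    indicator of [A] under the integral, which gives the signs needed. *)
Lemma cond_probability_ae01 : {ae P, forall w, (0 <= f w <= 1)%R}.
Proof.
have [fG fi fE] := hf.
have i1 : P.-integrable [set: T] (EFin \o cst 1%R).
  exact: finite_measure_integrable_cst.
have ae0 : {ae P, forall w, (0 <= f w)%R}.
  apply: ge0_ae_of_integral => //; rewrite fE.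
    by apply: integral_ge0 => w _; rewrite lee_fin.
  rewrite (_ : [set _ | _] = f @^-1` `]-oo, 0%R[); first exact: fG.
  by apply/seteqP; split => w /=; rewrite in_itv.
have ae1 : {ae P, forall w, (0 <= 1 - f w)%R}.
  have GB : G [set w | (1 - f w < 0)%R].
    rewrite (_ : [set _ | _] = f @^-1` `]1%R, +oo[); first exact: fG.
    by apply/seteqP; split => w /=; rewrite in_itv/= andbT subr_lt0.
  have mB := GT GB.
  apply: ge0_ae_of_integral.
    rewrite (_ : _ \o _ = (EFin \o cst 1%R) \- (EFin \o f)).
      exact: integrableB.
    by apply/funext.
  under eq_integral do rewrite EFinB.
  rewrite integralB//.
  - rewrite fE// integral_indic// integral_cst// mul1e.
    have mI := measurableI _ _ mA mB.
    rewrite sube_ge0 ?fin_num_measure//.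
    by apply: le_measure; rewrite ?inE.
  - exact: integrableS i1.
  - exact: integrableS fi.
by apply: filterS2 ae0 ae1 => w f0 f1; rewrite f0 -subr_ge0.
Qed.

(** Cutting a version off at 0 and 1 changes it on a null set only and keeps it [G]-measurable; the
    bounds then hold at every point. *)
Definition clamp01 (x : R) : R := Num.min (Num.max x 0%R) 1%R.

Lemma clamp01_itv x : (0 <= clamp01 x <= 1)%R.
Proof. by rewrite /clamp01 le_min ge_min le_max !lexx ler01 !orbT. Qed.

Lemma clamp01_id x : (0 <= x <= 1)%R -> clamp01 x = x.
Proof. by move=> /andP[x0 x1]; rewrite /clamp01 max_l// min_l. Qed.

Lemma measurable_clamp01 : measurable_fun [set: R] clamp01.
Proof.
by apply: measurable_minr => //; exact: measurable_maxr.
Qed.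

Lemma clamp01_cond_probability_integral B : G B ->
  \int[P]_(w in B) (clamp01 (f w))%:E = \int[P]_(w in B) (\1_A w)%:E.
Proof.
have [fG fi fE] := hf => GB; have mB := GT GB; rewrite -fE//.
have mf := measurable_cond_probability.
apply: ae_eq_integral => //.
- apply/measurable_EFinP/measurable_funTS.
  by apply: measurableT_comp => //; exact: measurable_clamp01.
- exact/measurable_EFinP/measurable_funTS.
- by apply: filterS cond_probability_ae01 => w f01 _; rewrite clamp01_id.
Qed.

Lemma clamp01_cond_probability_preimage (B : set R) : measurable B ->
  G ((clamp01 \o f) @^-1` B).
Proof.
have [fG _ _] := hf => mB; rewrite comp_preimage; apply: fG.
by rewrite -[X in measurable X]setTI; exact: measurable_clamp01.
Qed.

End conditional_probability.

(** * Measurability of limits *)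

Section limits.
Context (R : realType).
Local Open Scope ereal_scope.

(** The sequence is squeezed between its tail infima and tail suprema. Convergence thereby becomes a
    condition on two measurable functions. *)
Lemma cvgn_limn_einf_esup (u : R^nat) :
  cvgn u <-> (limn_einf (EFin \o u) = limn_esup (EFin \o u)) /\
             limn_esup (EFin \o u) \is a fin_num.
Proof.
split=> [cu|[Einf Efin]].
  have : (EFin \o u) @ \oo --> (limn u)%:E.
    by apply: cvg_EFin; [exact: nearW|exact: cu].
  by move=> /cvg_limn_einf_sup[-> ->].
apply/cvg_ex; exists (fine (limn_esup (EFin \o u))).
suff /fine_cvgP[] : (EFin \o u) @ \oo --> (fine (limn_esup (EFin \o u)))%:E by [].
rewrite fineK//.
apply: (@squeeze_cvge _ _ _ _ (einfs (EFin \o u)) _ (esups (EFin \o u))).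
- apply: nearW => n; apply/andP; split.
    by apply: ereal_inf_lbound; exists n => /=.
  by apply: ereal_sup_ubound; exists n => /=.
- by rewrite -Einf limn_einf_lim; exact: is_cvg_einfs.
- by rewrite limn_esup_lim; exact: is_cvg_esups.
Qed.

Context (d : measure_display) (T : measurableType d).

Lemma measurable_limn_einf (h : nat -> T -> \bar R) :
  (forall n, measurable_fun [set: T] (h n)) ->
  measurable_fun [set: T] (fun w => limn_einf (h ^~ w)).
Proof.
move=> mh; rewrite /limn_einf; apply: measurableT_comp => //.
apply: (@measurable_fun_limn_esup _ _ _ _ (fun n w => - h n w)) => n.
exact: measurableT_comp.
Qed.

(* Where the sequence diverges, its limit is a junk constant. *)
Lemma measurable_limn (h : nat -> T -> R) :
  (forall n, measurable_fun [set: T] (h n)) ->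
  measurable_fun [set: T] (fun w => limn (h ^~ w)).
Proof.
move=> mh.
have mEh n : measurable_fun [set: T] (EFin \o h n) by exact/measurable_EFinP.
pose s w := limn_esup (fun n => (h n w)%:E).
pose i w := limn_einf (fun n => (h n w)%:E).
have ms : measurable_fun [set: T] s by exact: (measurable_fun_limn_esup mEh).
have mi : measurable_fun [set: T] i by exact: (measurable_limn_einf mEh).
rewrite (_ : (fun w => _) =
    fun w => if (i w == s w) && (s w \is a fin_num) then fine (s w) else point).
  apply: measurable_fun_ifT => //.
    apply: measurable_and.
      exact: measurable_fun_eqe.
    rewrite (_ : (fun w => _) = (fun w => `|s w| < +oo)); last first.
      by apply/funext => w; rewrite -fin_num_abs.
    by apply: measurable_fun_lte => //; exact: measurableT_comp.
  exact: measurableT_comp.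
apply/funext => w; case: ifPn => [/andP[/eqP Eis sfin]|nis].
  have /cvgn_limn_einf_esup cu : i w = s w /\ s w \is a fin_num by [].
  have := cu; rewrite (_ : s w = (limn (h ^~ w))%:E)//.
  have : (EFin \o h^~ w) @ \oo --> (limn (h^~ w))%:E.
    by apply: cvg_EFin; [exact: nearW|exact: cu].
  by move=> /cvg_limn_einf_sup[_].
apply: dvgP => /cvgn_limn_einf_esup[Eis sfin]; move/negP: nis; apply.
by apply/andP; split => //; apply/eqP.
Qed.

End limits.

(** * The stop-loss bound *)

Section sub_sigma_algebra.
Context (R : realType) (T : pointedType) (G : set_system T).
Hypothesis sigmaG : sigma_algebra [set: T] G.

(** Makes the closure of measurable functions under sums available for a sub-sigma-field given as a
    bare set system. *)
Lemma preimage_sub_sigma_algebra (f : T -> R) :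
  (forall B : set R, measurable B -> G (f @^-1` B)) <->
  measurable_fun [set: g_sigma_algebraType G] (f : g_sigma_algebraType G -> R).
Proof.
have GE := measurable_g_measurableTypeE sigmaG.
split=> [fG _ B mB|mf B mB].
  by rewrite setTI GE; exact: fG.
by have := mf measurableT B mB; rewrite setTI GE.
Qed.

End sub_sigma_algebra.

(** * The potential of a hinge *)

Section potential.
Variable R : realType.
Implicit Types c x y : R.

(* The derivative of the potential [x |-> E (hinge c (x + X))], [X] exponential;
   the potential itself is [hinge c + hinge_drift c]. *)
Definition hinge_drift c x : R := expR (Num.min (x - c) 0).

Lemma hinge_drift_01 c x : 0 <= hinge_drift c x <= 1.
Proof. by rewrite expR_ge0/= -expR0 ler_expR ge_min lexx orbT. Qed.

Lemma hinge_drift_le c x y : x <= y -> hinge_drift c x <= hinge_drift c y.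
Proof.
move=> xy; rewrite ler_expR le_min !ge_min lexx !orbT andbT.
by rewrite lerD2r xy.
Qed.

Lemma measurable_hinge_drift c : measurable_fun [set: R] (hinge_drift c).
Proof.
apply: measurableT_comp; first exact: measurable_expR.
by apply: measurable_minr => //; exact: measurable_funB.
Qed.

(** A convex function grows by at most the length times its derivative at the right end. In each
    position of [c] this reduces to [1 + t <= expR t]. *)
Lemma hinge_drift_increment c x y : x <= y ->
  (hinge c y + hinge_drift c y) - (hinge c x + hinge_drift c x) <=
  (y - x) * hinge_drift c y.
Proof.
move=> xy; rewrite /hinge_drift.
have [cx|/ltW xc] := leP c x.
  have cy := le_trans cx xy.
  by rewrite !hinge_ge// !min_r ?subr_ge0// expR0; lra.
have H1 := expR_ge1Dx (x - c).
rewrite (hinge_le xc) (@min_l _ _ (x - c)) ?subr_le0//.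
have [cy|/ltW yc] := leP c y.
  by rewrite hinge_ge// min_r ?subr_ge0// expR0; lra.
rewrite hinge_le// min_l ?subr_le0//.
have -> : x - c = (x - y) + (y - c) by ring.
rewrite (expRD (x - y)); have := ler_wpM2r (expR_ge0 (y - c)) (expR_ge1Dx (x - y)).
lra.
Qed.

End potential.

(** * Hinges of the partial sums and the mean of the series *)

Section stop_loss_bound.
Local Open Scope ereal_scope.
Context (R : realType) (d : measure_display) (T : measurableType d)
  (P : probability T R) (Z : {RV P >-> nat}) (F : nat -> set_system T)
  (q : nat -> T -> R).
Hypotheses (hZ : forall w, (0 < Z w)%N) (hF : filtration F).
Hypothesis q01 : forall n w, (0 <= q n w <= 1)%R.
Hypothesis qF : forall n (B : set R), measurable B -> F n (q n @^-1` B).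
Hypothesis qE : forall n B, F n B ->
  \int[P]_(w in B) (q n w)%:E = \int[P]_(w in B) (\1_[set w | Z w = n.+1] w)%:E.

Let q0 n w : (0 <= q n w)%R. Proof. by case/andP: (q01 n w). Qed.

Let mq n : measurable_fun [set: T] (q n).
Proof. by case: hF => _ FT _ _ B mB; rewrite setTI; apply: (FT n); exact: qF. Qed.

Let mZ n : measurable [set w | Z w = n].
Proof.
rewrite (_ : [set _ | _] = Z @^-1` [set n])// -[X in measurable X]setTI.
exact: measurable_funPT.
Qed.

Let S N w : R := series (q ^~ w) N.

Let S_recr N w : S N.+1 w = (S N w + q N w)%R.
Proof. by rewrite /S /series/= big_nat_recr. Qed.

Let S_nondecreasing w : nondecreasing_seq (S ^~ w).
Proof. by apply/nondecreasing_seqP => n; rewrite S_recr lerDl. Qed.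

(** Predictability: [S n.+1] involves only [q k] with [k <= n], each measurable for [F k], which is
    contained in [F n]. *)
Let S_adapted n (B : set R) : measurable B -> F n (S n.+1 @^-1` B).
Proof.
case: hF => sF _ Fmono; move: B.
apply/(preimage_sub_sigma_algebra (sF n)).
rewrite (_ : S n.+1 = fun w => (\sum_(k < n.+1) q k w)%R); last first.
  by apply/funext => w; rewrite /S /series/= big_mkord.
apply: measurable_sum => k; apply/(preimage_sub_sigma_algebra (sF n)) => B mB.
by apply: (Fmono k n); [rewrite -ltnS|exact: qF].
Qed.

Let mS N : measurable_fun [set: T] (S N).
Proof.
case: N => [|n] _ B mB; rewrite setTI.
  rewrite (_ : S 0 = cst 0%R); first by rewrite -[X in measurable X]setTI; exact: measurable_cst.
  by apply/funext => w; rewrite /S /series/= big_nil.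
by case: hF => _ FT _; apply: (FT n); exact: S_adapted.
Qed.

(** The increments of the potential telescope along the partial sums, starting from its value
    [expR (- c)] at [S 0 w = 0]. *)
Lemma hinge_partial_sum_le c w N : (0 <= c)%R ->
  (hinge c (S N w) + hinge_drift c (S N w) <=
   expR (- c) + \sum_(n < N) q n w * hinge_drift c (S n.+1 w))%R.
Proof.
move=> c0; elim: N => [|N IH].
  rewrite big_ord0 addr0 /S /series/= big_nil hinge_le// add0r.
  by rewrite /hinge_drift sub0r min_l// oppr_le0.
rewrite big_ord_recr/=.
have SN : (S N w <= S N.+1 w)%R by rewrite S_recr lerDl.
have := hinge_drift_increment c SN.
have -> : (S N.+1 w - S N w = q N w)%R by rewrite S_recr; ring.
lra.
Qed.

Let g c N w := hinge_drift c (S N w).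

Let mg c N : measurable_fun [set: T] (g c N).
Proof. by apply: measurableT_comp => //; exact: measurable_hinge_drift. Qed.

Let g01 c N w : (0 <= g c N w <= 1)%R.
Proof. exact: hinge_drift_01. Qed.

Let g0 c N w : (0 <= g c N w)%R.
Proof. by case/andP: (g01 c N w). Qed.

Let mMg (f : T -> R) c N : measurable_fun [set: T] f ->
  measurable_fun [set: T] (fun w => (f w * g c N w)%:E).
Proof. by move=> mf; apply/measurable_EFinP; exact: measurable_funM. Qed.

(** [S n.+1] being [F n]-measurable, [q n] can be exchanged for the indicator; monotonicity then
    moves the drift to time [N], giving a factor common to all [n < N]. *)
Let integral_drift_le c n N : (n < N)%N ->
  \int[P]_w (q n w * g c n.+1 w)%:E <=
  \int[P]_w (\1_[set w | Z w = n.+1] w * g c N w)%:E.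
Proof.
move=> nN; case: (hF) => _ FT _.
apply: (@le_trans _ _
    (\int[P]_w (\1_[set w | Z w = n.+1] w * g c n.+1 w)%:E)).
  apply: (@pull_out_le _ _ _ _ (F n)) => //.
  - exact: qE.
  - move=> a; have -> : [set w | (a <= g c n.+1 w)%R] =
        S n.+1 @^-1` (hinge_drift c @^-1` `[a, +oo[).
      by apply/seteqP; split => w /=; rewrite in_itv/= andbT.
    apply: S_adapted; rewrite -[X in measurable X]setTI.
    exact: measurable_hinge_drift.
apply: ge0_le_integral => //.
- by move=> w _; rewrite lee_fin mulr_ge0.
- by apply: mMg; exact: measurable_indic.
- by apply: mMg; exact: measurable_indic.
- move=> w _; rewrite lee_fin ler_wpM2l//.
  by apply: hinge_drift_le; exact: S_nondecreasing.
Qed.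

Let sum_indic_le1 N w : (\sum_(n < N) \1_[set w | Z w = n.+1] w <= 1 :> R)%R.
Proof.
have [NZ|ZN] := ltnP N (Z w).
  rewrite big1// => n _; rewrite indicE memNset//= => Zn.
  by move: NZ; rewrite Zn ltnNge ltn_ord.
have Zn : ((Z w).-1 < N)%N by rewrite prednK.
rewrite (bigD1 (Ordinal Zn))//= big1 ?addr0; first by rewrite indicE lern1 leq_b1.
move=> n /eqP nZ; rewrite indicE memNset//= => Zwn; apply: nZ.
by apply: val_inj; rewrite /= Zwn.
Qed.

Lemma hinge_partial_sum_integral c N : (0 <= c)%R ->
  \int[P]_w (hinge c (S N w))%:E <= (expR (- c))%:E.
Proof.
move=> c0.
have gfin : \int[P]_w (g c N w)%:E \is a fin_num.
  rewrite ge0_fin_numE; last by apply: integral_ge0 => w _; rewrite lee_fin.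
  apply: (@le_lt_trans _ _ (\int[P]_w 1)).
    apply: ge0_le_integral => //; first by move=> w _; rewrite lee_fin.
      exact/measurable_EFinP.
    by move=> w _; rewrite lee_fin; case/andP: (g01 c N w).
  by rewrite integral_cst// mul1e -ge0_fin_numE// fin_num_measure.
have mh : measurable_fun [set: T] (fun w => (hinge c (S N w))%:E).
  by apply/measurable_EFinP; apply: measurableT_comp => //; exact: measurable_hinge.
(* Adding the finite mean of the drift to both sides turns the hinge on the left into the full
   potential. *)
rewrite -(leeD2rE _ _ gfin) -ge0_integralD//; last 3 first.
- by move=> w _; rewrite lee_fin hinge_ge0.
- by move=> w _; rewrite lee_fin.
- exact/measurable_EFinP.
apply: (@le_trans _ _ (\int[P]_w ((expR (- c))%:E +
    \sum_(n < N) (q n w * g c n.+1 w)%:E))).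
  apply: ge0_le_integral => //.
  - by move=> w _; rewrite adde_ge0// lee_fin ?hinge_ge0.
  - by apply: emeasurable_funD => //; exact/measurable_EFinP.
  - apply: emeasurable_funD => //; apply: emeasurable_sum => n.
    exact: mMg.
  - move=> w _; rewrite sumEFin -!EFinD lee_fin.
    exact: hinge_partial_sum_le.
rewrite ge0_integralD//; last 2 first.
- by move=> w _; apply: sume_ge0 => n _; rewrite lee_fin mulr_ge0.
- by apply: emeasurable_sum => n; exact: mMg.
rewrite integral_cst//= [P _]probability_setT mule1 leeD2l//.
rewrite ge0_integral_sum//; last 2 first.
- by move=> n; exact: mMg.
- by move=> n w _; rewrite lee_fin mulr_ge0.
apply: (@le_trans _ _ (\sum_(n < N)
    \int[P]_w (\1_[set w | Z w = n.+1] w * g c N w)%:E)).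
  by apply: lee_sum => n _; exact: integral_drift_le.
rewrite -ge0_integral_sum//; last 2 first.
- by move=> n; apply: mMg; exact: measurable_indic.
- by move=> n w _; rewrite lee_fin mulr_ge0.
apply: ge0_le_integral => //.
- by move=> w _; apply: sume_ge0 => n _; rewrite lee_fin mulr_ge0.
- by apply: emeasurable_sum => n; apply: mMg; exact: measurable_indic.
- exact/measurable_EFinP.
- move=> w _; rewrite sumEFin lee_fin -mulr_suml -[leRHS]mul1r.
  exact: ler_wpM2r.
Qed.

(** By Tonelli and the defining property of [q n] on the whole space, this is the sum of the
    probabilities of [Z = n + 1]; these events partition the space because [Z] is positive. *)
Lemma integral_nneseries_eq1 : \int[P]_w \sum_(n <oo) (q n w)%:E = 1.
Proof.
rewrite integral_nneseries//; last 2 first.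
- by move=> n; exact/measurable_EFinP.
- by move=> n w _; rewrite lee_fin.
have -> : (fun N => \sum_(0 <= n < N) \int[P]_w (q n w)%:E) =
          (fun N => \sum_(0 <= n < N) P [set w | Z w = n.+1]).
  apply/funext => N; apply: eq_bigr => n _.
  case: (hF) => sF _ _.
  have FT : F n [set: T] by have [F0 FC _] := sF n; rewrite -(setD0 setT); exact: FC.
  by rewrite qE// integral_indic// setIT.
rewrite -measure_semi_bigcup//.
- rewrite (_ : \bigcup_n _ = [set: T]); first exact: probability_setT.
  apply/seteqP; split => // w _; exists (Z w).-1 => //=.
  by rewrite prednK.
- by apply/trivIsetP => i j _ _ ij; apply/seteqP; split => // w [/= ->] [/eqP]; rewrite (negbTE ij).
- by apply: bigcup_measurable.
Qed.

Lemma ae_nneseries_fin : {ae P, forall w, \sum_(n <oo) (q n w)%:E \is a fin_num}.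
Proof.
have mq' : measurable_fun [set: T] (fun w => \sum_(n <oo) (q n w)%:E).
  apply: ge0_emeasurable_sum => [n w _ _|n _]; first by rewrite lee_fin.
  exact/measurable_EFinP.
have : P.-integrable [set: T] (fun w => \sum_(n <oo) (q n w)%:E).
  apply/integrableP; split => //.
  under eq_integral.
    move=> w _; rewrite gee0_abs; last by apply: nneseries_ge0 => n _ _; rewrite lee_fin.
    over.
  by rewrite integral_nneseries_eq1 ltry.
by move=> /integrable_ae -/(_ measurableT); apply: filterS => w; exact.
Qed.

Lemma series_cvg_nneseries w : \sum_(n <oo) (q n w)%:E \is a fin_num ->
  series (q ^~ w) @ \oo --> fine (\sum_(n <oo) (q n w)%:E).
Proof.
move=> fin.
have : (fun N => \sum_(0 <= n < N) (q n w)%:E) @ \oo -->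
       (fine (\sum_(n <oo) (q n w)%:E))%:E.
  rewrite fineK//; apply: is_cvg_nneseries => n _ _; first by rewrite lee_fin.
move=> /fine_cvgP[_]; apply: cvg_trans.
apply: near_eq_cvg; apply: nearW => N /=.
by rewrite sumEFin.
Qed.

End stop_loss_bound.

(** * Choice of versions, passage to the limit and conclusion *)

Theorem theorem1 (R : realType)
    (d : measure_display) (T : measurableType d) (P : probability T R)
    (Z : {RV P >-> nat}) (hZ : forall w, (0 < Z w)%N)
    (F : nat -> set_system T) (hF : filtration F)
    (p : nat -> T -> R)
    (hp : forall n, is_cond_probability P (F n) [set w | Z w = n.+1] (p n))
    (d' : measure_display) (T' : measurableType d') (Q : probability T' R)
    (X : {RV Q >-> R}) (hX : exponential_law 1 X) :
  let Y := fun w => limn (series (fun n => p n w)) in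
  {ae P, forall w, cvgn (series (fun n => p n w))} /\ convex_le P Q Y X.
Proof.
move=> Y; case: (hF) => sF FT _.
have mZ n : measurable [set w | Z w = n.+1].
  rewrite (_ : [set _ | _] = Z @^-1` [set n.+1])// -[X in measurable X]setTI.
  exact: measurable_funPT.
have mp n : measurable_fun [set: T] (p n).
  exact: measurable_cond_probability (FT n) (hp n).
(* These versions obey the bounds everywhere and, by countability, agree with [p] for all [n] off a
   single null set. *)
pose q n w := clamp01 (p n w).
have q01 n w : 0 <= q n w <= 1 by exact: clamp01_itv.
have qF n B : measurable B -> F n (q n @^-1` B).
  exact: (clamp01_cond_probability_preimage (hp n)).
have qE n B : F n B -> (\int[P]_(w in B) (q n w)%:E =
    \int[P]_(w in B) (\1_[set w | Z w = n.+1] w)%:E)%E.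
  exact: (clamp01_cond_probability_integral (FT n) (mZ n) (hp n)).
have aepq : {ae P, forall w, forall n, p n w = q n w}.
  apply: ae_foralln => n.
  have := cond_probability_ae01 (FT n) (mZ n) (hp n).
  by apply: filterS => w p01; rewrite /q clamp01_id.
have mS N : measurable_fun [set: T] (fun w => series (q ^~ w) N).
  rewrite /series /=; apply: measurable_sum => n.
  by apply: measurableT_comp; [exact: measurable_clamp01|exact: mp].
have mY : measurable_fun [set: T] Y.
  apply: (@measurable_limn _ _ _ (fun N w => series (p ^~ w) N)) => N.
  by rewrite /series /=; apply: measurable_sum.
(* [Y] takes a default value where the series diverges, and [X] may be negative on a null set. The
   positive parts are nonnegative everywhere and agree almost everywhere with the originals. *)
pose Y1 w : R := Num.max (Y w) 0.
pose X1 w := Num.max (X w) 0.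
have mY1 : measurable_fun [set: T] Y1 by exact: measurable_maxr.
have mX1 : measurable_fun [set: T'] X1 by exact: measurable_maxr.
have Y1_ge0 w : 0 <= Y1 w by rewrite le_max lexx orbT.
have X1_ge0 w : 0 <= X1 w by rewrite le_max lexx orbT.
have aeY : {ae P, forall w, [/\ cvgn (series (p ^~ w)), Y1 w = Y w,
    (Y1 w)%:E = (\sum_(n <oo) (q n w)%:E)%E & series (q ^~ w) @ \oo --> Y1 w]}.
  have := ae_nneseries_fin hZ hF q01 qF qE.
  apply: filterS2 aepq => w pq fin.
  have cq := series_cvg_nneseries q01 fin.
  have epq : p^~ w = q^~ w by apply/funext => n; exact: pq.
  have YE : Y w = fine (\sum_(n <oo) (q n w)%:E)%E.
    by rewrite /Y epq; exact/cvg_lim.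
  have Y1E : Y1 w = Y w.
    rewrite /Y1 max_l// YE fine_ge0//; apply: nneseries_ge0 => n _ _.
    by rewrite lee_fin; case/andP: (q01 n w).
  split; rewrite ?epq//; last by rewrite Y1E YE.
  - by apply/cvg_ex; eexists; exact: cq.
  - by rewrite Y1E YE fineK.
split; first by apply: filterS aeY => w [].
have intY1 : (\int[P]_w (Y1 w)%:E = 1)%E.
  rewrite -(integral_nneseries_eq1 hZ hF q01 qF qE).
  apply: ae_eq_integral => //.
  - exact/measurable_EFinP.
  - apply: ge0_emeasurable_sum => [n w _ _|n _].
      by rewrite lee_fin; case/andP: (q01 n w).
    apply/measurable_EFinP.
    by apply: measurableT_comp; [exact: measurable_clamp01|exact: mp].
  - by apply: filterS aeY => w [].
have hingeX1 c w : 0 <= c -> hinge c (X1 w) = hinge c (X w).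
  move=> c0; rewrite /X1; have [x0|/ltW x0] := leP 0 (X w); first by [].
  by rewrite !hinge_le// (le_trans x0).
have intX1 : (\int[Q]_w (X1 w)%:E = 1)%E.
  (* The mean is read off as the hinge integral at [c = 0]. *)
  rewrite -[RHS](_ : (expR (- 0))%:E = _)%E; last by rewrite oppr0 expR0.
  rewrite -(exponential_hinge hX)//.
  by apply: eq_integral => w _; rewrite /hinge subr0.
have int1 d0 (T0 : measurableType d0) (P0 : probability T0 R) (W : T0 -> R) :
    measurable_fun [set: T0] W -> (forall w, 0 <= W w) ->
    (\int[P0]_w (W w)%:E = 1)%E -> P0.-integrable [set: T0] (EFin \o W).
  move=> mW W0 W1; apply/integrableP; split; first exact/measurable_EFinP.
  under eq_integral do rewrite gee0_abs ?lee_fin//.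
  by rewrite W1 ltry.
have stop_loss c : 0 <= c -> (\int[P]_w (hinge c (Y1 w))%:E <=
    \int[Q]_w (hinge c (X1 w))%:E)%E.
  move=> c0; under [leRHS]eq_integral do rewrite hingeX1//.
  rewrite exponential_hinge//.
  have mhinge (f : T -> R) : measurable_fun [set: T] f ->
      measurable_fun [set: T] (fun w => (hinge c (f w))%:E).
    move=> mf; apply/measurable_EFinP.
    by apply: measurableT_comp => //; exact: measurable_hinge.
  (* Almost everywhere the hinge of the limit is the limit of the hinges; written as a lower limit
     it is defined everywhere and ready for Fatou's lemma. *)
  have -> : (\int[P]_w (hinge c (Y1 w))%:E =
      \int[P]_w limn_einf (fun N => (hinge c (series (q ^~ w) N))%:E))%E.
    apply: ae_eq_integral => //; first exact: mhinge.
      by apply: measurable_limn_einf => N; exact: mhinge.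
    apply: filterS aeY => w [_ _ _ cq] _.
    have : (fun N => (hinge c (series (q ^~ w) N))%:E) @ \oo -->
        (hinge c (Y1 w))%:E.
      apply: cvg_EFin; first exact: nearW.
      apply: (@continuous_cvg _ _ _ _ _ _ (hinge c)) => //.
      exact: continuous_hinge.
    by move=> /cvg_limn_einf_sup[->].
  apply: le_trans (fatou _ _ _ _) _ => //.
  - by move=> N; exact: mhinge.
  - by move=> N w _; rewrite lee_fin hinge_ge0.
  rewrite limn_einf_lim; apply: lime_le; first exact: is_cvg_einfs.
  apply: nearW => N; apply: le_trans (ereal_inf_lbound _) _.
    by exists N => /=.
  exact: (hinge_partial_sum_integral hZ hF q01 qF qE).
move=> phi /convex_three_chord cphi; rewrite unlock.
have mphi : measurable_fun [set: R] phi.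
  by apply: continuous_measurable_fun; exact: three_chord_continuous.
have -> : (\int[P]_w ((phi \o Y) w)%:E = \int[P]_w (phi (Y1 w))%:E)%E.
  apply: ae_eq_integral => //.
  - by apply/measurable_EFinP; exact: measurableT_comp.
  - by apply/measurable_EFinP; exact: measurableT_comp.
  - by apply: filterS aeY => w [_ /= -> _ _].
have -> : (\int[Q]_w ((phi \o X) w)%:E = \int[Q]_w (phi (X1 w))%:E)%E.
  apply: ae_eq_integral => //.
  - by apply/measurable_EFinP; exact: measurableT_comp.
  - by apply/measurable_EFinP; exact: measurableT_comp.
  - by apply: filterS (exponential_ge0_ae hX) => w X0 _ /=; rewrite /X1 max_l.
apply: stop_loss_convex_le => //.
- exact: int1.
- exact: int1.
- by rewrite intY1 intX1.
Qed.
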